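(* Let $\alpha$ be an action of a discrete group $G$ on a locally compact Hausdorff space $X$. Assume $\dim(X^+)\leq d$ for some $d\in\mathbb{N}$. Then $$\dim_{\mathrm{LTC}}(\alpha)\leq\mathrm{LSP}_d(G)-1.$$
   Context: $\mathbb{N}$ includes $0$. $\Subset$ means compact subset (finite subset in a discrete group). $X^+$ is the one-point compactification of $X$ and $\dim$ is covering dimension (infimum of nonnegative integers $d$ such that every finite open cover has an open refinement covering the space with every point in at most $d+1$ members). Large scale packing constants: for a discrete group $G$ and a nonnegative integer $d$, $\mathrm{LSP}_d(G)$ is the infimum of all nonnegative integers $m$ (possibly $\infty$) such that for any finite $L\Subset G$ there is a finite symmetric subset $N\Subset G$ containing $e$ (so $e\in N=N^{-1}$) with the property: for any $n>m$ and any $g_1,\dots,g_n\in NL$ there is a subset $F\subseteq\{1,\dots,n\}$ with $|F|>d+1$ and $g_ig_j^{-1}\in N$ for all $i,j\in F$. Here $NL=\{ab\colon a\in N,b\in L\}$. Long thin covering dimension: write $\alpha_L(x)=\{\alpha_g(x)\colon g\in L\}$, and let $\operatorname{mult}(\mathcal{U})=\sup_{x\in X}|\{U\in\mathcal{U}\colon x\in U\}|$. $\dim_{\mathrm{LTC}}(\alpha)$ is the infimum of all natural numbers $d$ satisfying: for any finite $L\Subset G$ and any compact $K\Subset X$ there is a natural number $N$ such that for any finite open cover $\mathcal{V}$ of $X$ there exist a collection $\mathcal{U}$ of open sets in $X$ and locally constant functions $\Lambda_U\colon U\to X$ ($U\in\mathcal{U}$) satisfying: (Lo) for any $x\in K$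 there is $U\in\mathcal{U}$ with $\alpha_L(x)\subseteq U$; (Mu) $\operatorname{mult}(\mathcal{U})\leq d+1$; (Eq) for any $U\in\mathcal{U}$, $x\in U$, $g\in L$, if $\alpha_g(x)\in U$ then $\Lambda_U(\alpha_g(x))=\alpha_g(\Lambda_U(x))$; (Th) for any $U\in\mathcal{U}$ and $y\in\Lambda_U(U)$ there is $V\in\mathcal{V}$ with $\Lambda_U^{-1}(y)\cup\{y\}\subseteq V$; (Ca) $|\Lambda_U(U)|\leq N$ for any $U\in\mathcal{U}$. *)

(* Defs.v *)
From mathcomp Require Import all_boot all_order all_algebra.
From mathcomp Require Import all_classical all_reals all_analysis.

Set Implicit Arguments.
Unset Strict Implicit.
Unset Printing Implicit Defensive.

Import Order.TTheory GRing.Theory Num.Theory.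

Local Open Scope classical_set_scope.
Local Open Scope card_scope.
Local Open Scope ring_scope.

(* Dimensions take values in the extended reals; [ereal_inf] of the empty set
   is +oo, and a nonempty set of naturals attains its infimum. *)
Definition inf_nat (R : realType) (P : set nat) : \bar R :=
  ereal_inf [set (n%:R%:E : \bar R) | n in P].

Definition open_cover (T : topologicalType) (Us : set (set T)) : Prop :=
  (forall U, Us U -> open U) /\ \bigcup_(U in Us) U = [set: T].

Definition refines (T : Type) (Ws Us : set (set T)) : Prop :=
  forall W, Ws W -> exists2 U, Us U & W `<=` U.

Definition covering_dim (R : realType) (T : topologicalType) : \bar R :=
  inf_nat R [set d : nat |
    forall Us : set (set T), finite_set Us -> open_cover Us ->
    exists Ws : set (set T), [/\ open_cover Ws, refines Ws Us &
      forall x, [set W | Ws W /\ W x] #<= `I_d.+1]].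

(* On the empty space this supremum is -oo instead of 0, which makes no
   difference to the upper bounds on it. *)
Definition mult (R : realType) (T : Type) (Us : set (set T)) : \bar R :=
  ereal_sup [set counting [set U | Us U /\ U x] | x in [set: T]].

(* The g_i are a family, so repetitions are allowed, and F is a set of
   indices. *)
Definition LSP (R : realType) (G : groupType) (d : nat) : \bar R :=
  inf_nat R [set m : nat |
    forall L : set G, finite_set L ->
    exists N : set G, [/\ finite_set N, N 1%g, [set a^-1%g | a in N] = N &
      forall n : nat, (m < n)%N ->
      forall g : 'I_n -> G,
        (forall i, [set (a * b)%g | a in N & b in L] (g i)) ->
      exists F : {set 'I_n}, (d.+1 < #|F|)%N /\
        forall i j, i \in F -> j \in F -> N (g i * (g j)^-1)%g]].

(* G carries the discrete topology, so joint continuity of the action amounts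
   to continuity of every [alpha g]. *)
Definition is_action (G : groupType) (X : topologicalType)
    (alpha : G -> X -> X) : Prop :=
  [/\ forall g, continuous (alpha g),
      forall x, alpha 1%g x = x &
      forall g h x, alpha (g * h)%g x = alpha g (alpha h x)].

Definition locally_constant_on (T : topologicalType) (S : Type) (U : set T)
    (f : T -> S) : Prop :=
  forall x, U x -> \forall y \near within U (nbhs x), f y = f x.

(* The functions Lambda_U : U -> X are represented by total functions
   [Lam U : X -> X] of which only the values on U are used.  The five final
   clauses are, in order, (Lo), (Mu), (Eq), (Th) and (Ca). *)
Definition dimLTC (R : realType) (G : groupType) (X : topologicalType)
    (alpha : G -> X -> X) : \bar R :=
  inf_nat R [set d : nat |
    forall (L : set G) (K : set X), finite_set L -> compact K ->
    exists N : nat,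
    forall Vs : set (set X), finite_set Vs -> open_cover Vs ->
    exists (Us : set (set X)) (Lam : set X -> X -> X),
      (forall U, Us U -> open U /\ locally_constant_on U (Lam U)) /\
      [/\ forall x, K x ->
            exists2 U, Us U & [set alpha g x | g in L] `<=` U,
          (mult R Us <= d.+1%:R%:E)%E,
          forall U x g, Us U -> U x -> L g -> U (alpha g x) ->
            Lam U (alpha g x) = alpha g (Lam U x),
          forall U y, Us U -> (Lam U @` U) y ->
            exists2 V, Vs V & (U `&` Lam U @^-1` [set y]) `|` [set y] `<=` V &
          forall U, Us U -> Lam U @` U #<= `I_N]].

(* Main.v *)
(* Let N be the finite set given by the packing condition for L^-1.  It suffices
   to find small open sets U_i such that the sets N U_i cover K while no point y
   has g_0 y, ..., g_(d+1) y in d+2 different U_i with all g_a g_b^-1 in N: then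
   the sets L N U_i satisfy (Lo), and by packing they have multiplicity at most
   LSP.  If U_i is small enough around x_i, then g U_i and h U_i, for g and h in
   a given finite set, meet only when g x_i = h x_i; so the map sending g U_i to
   g x_i is well defined on L N U_i, and it is equivariant.

   The U_i are built greedily.  Given U_i for i < j, the new U_j must avoid the
   points x with h_a x in U_(i_a) for d+1 different indices i_a and some h_a in
   N, and must contain what the N U_i do not reach yet.  These demands conflict
   only at points x such that every h_a x lies on the boundary of U_(i_a).  As
   the indices are different, dim X^+ <= d allows one to perturb the U_i so that
   there are no such points.  To keep room for later perturbations, boundaries
   are thickened to differences of an open set and a smaller compact set. *)
Require Import Defs.
From mathcomp Require Import all_boot all_order all_algebra.
From mathcomp Require Import all_classical all_reals all_analysis.

Set Implicit Arguments.
Unset Strict Implicit.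
Unset Printing Implicit Defensive.

Import Order.TTheory GRing.Theory Num.Theory.
Import numFieldNormedType.Exports.

Local Open Scope classical_set_scope.
Local Open Scope card_scope.
Local Open Scope ring_scope.

(** * Counting and finite covers *)

Lemma leq_card_inj (I : finType) (S : Type) (A : set S) (n : nat)
    (s : {set I}) (f : I -> S) :
  A #<= `I_n -> {in s &, injective f} -> (forall i, i \in s -> A (f i)) ->
  (#|s| <= n)%N.
Proof.
move=> /pcard_leP/injfunPex[g gA gI] fI fA.
rewrite cardE -(size_iota 0 n) -(size_map (g \o f)); apply: uniq_leq_size.
  rewrite map_inj_in_uniq ?enum_uniq// => i j; rewrite !mem_enum => si sj /= gE.
  by apply: fI => //; apply: gI gE; rewrite inE; exact: fA.
move=> k /mapP[i]; rewrite mem_enum => si ->; rewrite mem_iota/=.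
by have := gA _ (fA i si).
Qed.

Lemma card_le_image_seq (S : eqType) (U : Type) (f : S -> U) (s : seq S) :
  f @` [set` s] #<= `I_(size s).
Proof.
apply: card_le_trans (card_image_le _ _) _.
apply/pcard_leP/injfunPex; exists (index^~ s).
  by move=> x /=; rewrite index_mem.
move=> x y /set_mem/= xs /set_mem/= ys e.
by rewrite -(nth_index x xs) e nth_index.
Qed.

Lemma le_counting_image (R : realType) (I : choiceType) (s : seq I)
    (T : choiceType) (f : I -> T) (A : set T) :
  A `<=` f @` [set` s] -> (counting A <= (size s)%:R%:E :> \bar R)%E.
Proof.
move=> As; have cA : A #<= `I_(size s).
  exact: card_le_trans (subset_card_le As) (card_le_image_seq _ _).
rewrite /counting asboolT; last by apply/finite_set_leP; exists (size s).
by rewrite lee_fin ler_nat; exact: geq_card_fset_set.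
Qed.

Lemma open_bigcap_fin (T : topologicalType) (I : choiceType) (D : set I)
    (F : I -> set T) :
  finite_set D -> (forall i, D i -> open (F i)) -> open (\bigcap_(i in D) F i).
Proof.
move=> fD oF; rewrite -[X in open X]setCK setC_bigcap; apply: closed_openC.
by apply: closed_bigcup => // i Di; exact/open_closedC/oF.
Qed.

Lemma compact_finite_cover (T : topologicalType) (K : set T) (N : T -> set T) :
  compact K -> (forall x, K x -> nbhs x (N x)) ->
  exists2 s : seq T, (forall z, z \in s -> K z) &
    forall x, K x -> exists2 z, z \in s & N z x.
Proof.
move=> /compact_near_coveringP cK nN.
(* For this filter, [eventually] means for all lists containing a given finite list. The
   near-covering property of [K] then yields one list that works for all points of [K]. *)
pose F : set_system (seq T) :=
  filter_from [set: seq T] (fun s => [set t | {subset s <= t}]).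
have FF : Filter F.
  apply: filter_from_filter; first by exists [::].
  move=> s t _ _; exists (s ++ t) => // u su.
  by split=> x xs; apply: su; rewrite mem_cat xs ?orbT.
have [] := cK _ F (fun s x => exists z, [/\ z \in s, K z & N z x]) FF.
  move=> x Kx; exists (N x, [set t | {subset [:: x] <= t}]).
    by split; [exact: nN | exists [:: x]].
  by case=> y t [/= Ny xt]; exists x; split => //; apply: xt; rewrite mem_head.
move=> s _ /(_ s) ssub; exists [seq z <- s | `[< K z >]].
  by move=> z; rewrite mem_filter => /andP[/asboolP].
move=> x Kx; have [//|z [zs Kz Nzx]] := ssub _ x Kx.
by exists z => //; rewrite mem_filter zs andbT; apply/asboolP.
Qed.

(** * Covering dimension and partitions in compact spaces *)

Definition covering_dim_le (T : topologicalType) (d : nat) :=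
  forall Us : set (set T), finite_set Us -> open_cover Us ->
    exists Ws : set (set T), [/\ open_cover Ws, refines Ws Us &
      forall x, [set W | Ws W /\ W x] #<= `I_d.+1].

(** The refinement property passes from any [n <= d] to [d]; so if it fails at [d], all naturals
    satisfying it exceed [d] and the infimum is at least [d.+1]. *)
Lemma covering_dimW (R : realType) (T : topologicalType) (d : nat) :
  (covering_dim R T <= d%:R%:E)%E -> covering_dim_le T d.
Proof.
move=> dimT; apply: contrapT => dimTN; move: dimT; apply/negP; rewrite -ltNge.
apply: (@lt_le_trans _ _ d.+1%:R%:E); first by rewrite lte_fin ltr_nat.
apply: le_ereal_inf_tmp => _ [n Pn <-]; rewrite lee_fin ler_nat ltnNge.
apply/negP => nd; apply: dimTN => Us fUs oUs.
have [Ws [oWs rWs cWs]] := Pn _ fUs oUs; exists Ws; split => // x.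
by apply: card_le_trans (cWs x) _; rewrite card_le_II.
Qed.

(* Merging the members of a refinement that lie in the same [U i] does not
   increase the multiplicity. *)
Lemma covering_dim_le_shrink (T : topologicalType) (d : nat) (I : finType)
    (U : I -> set T) :
  covering_dim_le T d ->
  (forall i, open (U i)) -> (forall x, exists i, U i x) ->
  exists V : I -> set T, [/\ forall i, open (V i), forall i, V i `<=` U i,
    forall x, exists i, V i x &
    forall x (s : {set I}), (forall i, i \in s -> V i x) -> (#|s| <= d.+1)%N].
Proof.
move=> dimT oU cU.
have [||Ws [[oWs cWs] rWs mWs]] := dimT (range U).
- exact/finite_image/finite_finset.
- split; first by move=> _ [i _ <-].
  apply/seteqP; split=> // x _; have [i Uix] := cU x.
  by exists (U i) => //; exists i.
have /choice[idx idxP] : forall W : set T, exists o : option I,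
    Ws W -> exists2 i, o = Some i & W `<=` U i.
  move=> W; have [/rWs[_ [i _ <-] WU]|nW] := pselect (Ws W).
    by exists (Some i) => _; exists i.
  by exists None.
exists (fun i => \bigcup_(W in [set W | Ws W /\ idx W = Some i]) W); split.
- by move=> i; apply: bigcup_open => W [/oWs].
- by move=> i x [W [/idxP[j ->] WU [<-]]] /WU.
- move=> x; have [W WsW Wx] : (\bigcup_(W in Ws) W) x by rewrite cWs.
  by have [i iE _] := idxP _ WsW; exists i, W.
- move=> x s sV.
  have /choice[f fP] : forall i, exists W : set T,
      i \in s -> [/\ Ws W, idx W = Some i & W x].
    move=> i; have [/sV[W [WsW iE] Wx]|] := boolP (i \in s); first by exists W.
    by exists set0.
  apply: (leq_card_inj (f := f) (mWs x)).
    by move=> i j /fP[_ + _] /fP[_ + _] => + + E; rewrite E => -> [].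
  by move=> i /fP[].
Qed.

(** By regularity every point has a neighbourhood whose closure lies in a single [V i]. Finitely
    many of these cover, and [F i] collects the closures contained in [V i]. *)
Lemma closed_shrink (T : topologicalType) (I : finType) (V : I -> set T) :
  hausdorff_space T -> compact [set: T] ->
  (forall i, open (V i)) -> (forall x, exists i, V i x) ->
  exists F : I -> set T, [/\ forall i, closed (F i), forall i, F i `<=` V i &
    forall x, exists i, F i x].
Proof.
move=> hT cT oV cV.
have /choice[N NP] : forall x : T, exists N : set T,
    nbhs x N /\ exists i, closure N `<=` V i.
  move=> x; have [i Vix] := cV x.
  have /(_ _ (V i))[|N Nx NV] := compact_regular hT cT (@filterT _ (nbhs x) _).
    exact: open_nbhs_nbhs.
  by exists N; split => //; exists i.
have [s _ sP] := compact_finite_cover cT (fun x _ => (NP x).1).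
exists (fun i => \bigcup_(z in [set z | z \in s /\ closure (N z) `<=` V i])
  closure (N z)); split.
- move=> i; apply: closed_bigcup => [|z _]; last exact: closed_closure.
  by apply: sub_finite_set (finite_seq s) => z [].
- by move=> i x [z [_]]; apply.
- move=> x; have [//|z zs Nzx] := sP x _; have [_ [i iP]] := NP z.
  by exists i, z => //; exact: subset_closure.
Qed.

(** A thickened form of the classical theorem that, in dimension at most [d], any [d.+1] pairs of
    disjoint closed sets (here [C i] and the complement of [U i]) have partitions with empty
    intersection. The differences of [U' i] and [C' i] play the role of the partitions. *)
Lemma covering_dim_le_partition (R : realType) (T : topologicalType) (d : nat)
    (C U : 'I_d.+1 -> set T) :
  hausdorff_space T -> compact [set: T] -> covering_dim_le T d ->
  (forall i, [/\ closed (C i), open (U i) & C i `<=` U i]) ->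
  exists C' U' : 'I_d.+1 -> set T,
    (forall i, [/\ closed (C' i), open (U' i), C i `<=` C' i,
                   C' i `<=` U' i & U' i `<=` U i]) /\
    forall x, ~ forall i, (U' i `\` C' i) x.
Proof.
move=> hT cT dimT CU.
pose O (s : {ffun 'I_d.+1 -> bool}) :=
  \bigcap_(i in [set: 'I_d.+1]) if s i then U i else ~` C i.
have [||V [oV VO cV mV]] := covering_dim_le_shrink (U := O) dimT.
- move=> s; apply: open_bigcap_fin => [|i _]; first exact: finite_finset.
  by have [cC oU _] := CU i; case: ifP => // _; exact: closed_openC.
- move=> x; exists [ffun i => `[< U i x >]] => i _; rewrite ffunE.
  case: asboolP => // nUx; have [_ _ CUi] := CU i.
  by move=> /CUi.
have [F [cF FV covF]] := closed_shrink hT cT oV cV.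
(* The superlevel sets of [g s] at heights [i.*2] and [i.*2.+1] are used for the
   index [i]: a point between them for every [i] lies in [V s] for [d.+1]
   different [s], and for one more where [g s] attains its maximum [M]. *)
pose M : R := d.*2.+1%:R.
have /choice[g gP] : forall s, exists g : T -> R, [/\ continuous g,
    forall x, F s x -> g x = M & forall x, 0 < g x -> V s x].
  move=> s; have disj : ~` V s `&` F s = set0.
    by apply/disjoints_subset; rewrite setCS; exact: FV.
  have nT : normal_space T by exact: compact_normal.
  have /(@uniform_separatorP _ R)[f [cf _ f0 f1]] :=
    (@normal_separatorP R T).1 nT _ _ (open_closedC (oV s)) (cF s) disj.
  exists (fun x => M * f x); split.
  - by move=> x; apply: cvgM; [exact: cvg_cst|exact: cf].
  - by move=> x Fx; rewrite (f1 (f x)) ?mulr1//; exists x.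
  - move=> x; apply: contraPP => nVx.
    by rewrite (f0 (f x)) ?mulr0 ?ltxx//; exists x.
(* If [s i] holds then [V s] lies in [U i]; otherwise [V s] misses [C i]. So the [s] in [D i]
   suffice to cover [C i] without leaving [U i]. *)
pose D i := [set s : {ffun 'I_d.+1 -> bool} | s i].
exists (fun i => \bigcup_(s in D i) g s @^-1` [set r | i.*2.+1%:R <= r]).
exists (fun i => \bigcup_(s in D i) g s @^-1` [set r | i.*2%:R < r]).
split=> [i|x xP].
  have [cC oU CUi] := CU i; split.
  - apply: closed_bigcup => [|s _]; first exact: finite_finset.
    have [cg _ _] := gP s.
    by move/continuous_closedP : cg; apply; exact: closed_ge.
  - apply: bigcup_open => s _; have [cg _ _] := gP s.
    by move/continuousP : cg; apply; exact: open_gt.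
  - move=> x Cx; have [s Fx] := covF x; exists s => /=.
      have /(_ i Logic.I) := VO _ _ (FV _ _ Fx).
      by rewrite /D/=; case: (s i).
    have [_ /(_ x Fx) -> _] := gP s.
    by rewrite ler_nat ltnS leq_double -ltnS.
  - move=> x [s si /= gx]; exists s => //=.
    by apply: lt_le_trans gx; rewrite ltr_nat.
  - move=> x [s si /= gx]; have [_ _ gV] := gP s.
    have /(_ i Logic.I) := VO _ _ (gV _ (le_lt_trans (ler0n _ _) gx)).
    by rewrite si.
have /choice[t tP] : forall i : 'I_d.+1, exists s, i.*2%:R < g s x < i.*2.+1%:R.
  move=> i; have [[s si /= gx] nC] := xP i; exists s; rewrite gx/= ltNge.
  by apply/negP => gx'; apply: nC; exists s.
have tI : injective t.
  (* The open intervals from [i.*2] to [i.*2.+1] are disjoint for different [i], so one value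
     [g s x] cannot serve two indices. *)
  move=> i j tij; apply/val_inj/eqP; rewrite eqn_leq.
  have /andP[a b] := tP i; have /andP[a' b'] := tP j.
  rewrite tij in a b; have := lt_trans a b'; have := lt_trans a' b.
  by rewrite !ltr_nat !ltnS !leq_double => -> ->.
have [s0 Fx] := covF x.
have gM : g s0 x = M by have [_ ->] := gP s0.
have s0t : s0 \notin t @: [set: 'I_d.+1]%SET.
  apply/imsetP => -[i _ s0E]; have /andP[_] := tP i.
  by rewrite -s0E gM ltr_nat ltnS ltn_double ltnNge -ltnS ltn_ord.
have := mV x (s0 |: t @: [set: 'I_d.+1]%SET)%SET.
rewrite cardsU1 s0t card_imset// cardsT card_ord ltnn => H.
suff: false by [].
apply: H => s; rewrite !inE => /orP[/eqP->|/imsetP[i _ ->]].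
- exact: FV.
- have [_ _] := gP (t i); apply; have /andP[a _] := tP i.
  exact: le_lt_trans a.
Qed.

(** * Passage to locally compact spaces *)

Lemma compact_preimage_some (X : topologicalType)
    (A : set (one_point_compactification X)) :
  compact A -> ~ A None -> compact (Some @^-1` A).
Proof.
move=> cA nA F FF FA; have [[q|] [Aq clq]] := cA (Some @ F) _ FA => //.
exists q; split=> // S B FS Bq.
have [|_ [[x Sx <-] [y By [yx]]]] :=
    clq (Some @` S) _ _ (one_point_compactification_some_nbhs _ _ Bq).
  exact: filterS (@preimage_image _ _ Some S) FS.
by exists x; split => //; rewrite -yx.
Qed.

(** In the one-point compactification the compact [C i] become closed and the [U i] stay open. The
    new sets remain inside the images of the [U i], hence miss infinity, so the new closed sets
    restrict to compact subsets of [X]. *)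
Lemma locally_compact_partition (R : realType) (X : topologicalType) (d : nat)
    (C U : 'I_d.+1 -> set X) :
  hausdorff_space X -> locally_compact [set: X] ->
  covering_dim_le (one_point_compactification X) d ->
  (forall i, [/\ compact (C i), open (U i) & C i `<=` U i]) ->
  exists C' U' : 'I_d.+1 -> set X,
    (forall i, [/\ compact (C' i), open (U' i), C i `<=` C' i,
                   C' i `<=` U' i & U' i `<=` U i]) /\
    forall x, ~ forall i, (U' i `\` C' i) x.
Proof.
move=> hX lX dimX CU; set T := one_point_compactification X.
pose sm : X -> T := Some.
have csm : continuous sm by exact: one_point_compactification_some_continuous.
have hT : hausdorff_space T by exact: one_point_compactification_hausdorff.
have cT : compact [set: T] by exact: one_point_compactification_compact.
have [|C' [U' [CU' CU'0]]] := @covering_dim_le_partition R T d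
    (fun i => sm @` C i) (fun i => sm @` U i) hT cT dimX.
  move=> i; have [cC oU CUi] := CU i; split.
  - apply: compact_closed => //; apply: continuous_compact => //.
    exact: continuous_subspaceT.
  - exact: one_point_compactification_open_some.
  - exact: image_subset.
exists (fun i => sm @^-1` C' i), (fun i => sm @^-1` U' i); split=> [i|x].
  have [cC' oU' CC' C'U' U'U] := CU' i; split.
  - apply: compact_preimage_some; last by move=> /C'U'/U'U[].
    exact: subclosed_compact cT _.
  - by move/continuousP : csm; apply.
  - by move=> x Cx; apply: CC'; exists x.
  - by move=> x /C'U'.
  - by move=> x /U'U[y Uy [<-]].
by move=> /CU'0.
Qed.

Lemma compact_open_between (X : topologicalType) (Z U : set X) :
  hausdorff_space X -> locally_compact [set: X] ->
  compact Z -> open U -> Z `<=` U ->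
  exists Q, [/\ open Q, compact (closure Q), Z `<=` Q & closure Q `<=` U].
Proof.
move=> hX lX cZ oU ZU.
have /choice[N NP] : forall x : X, exists N : set X, compact (closure N) /\
    (Z x -> nbhs x N /\ closure N `<=` U).
  move=> x; have [Zx|nZx] := pselect (Z x); last first.
    (* The default value off [Z] keeps [closure (N x)] compact for every [x]. *)
    by exists set0; rewrite closure0; split=> //; exact: compact0.
  have [V] := lX x Logic.I; rewrite withinET => Vx [cV clV].
  have [|N Nx NUV] := compact_regular hX cV Vx (_ : nbhs x (U `&` V)).
    by apply: filterI => //; apply: open_nbhs_nbhs; split => //; exact: ZU.
  exists N; split=> [|_]; last by split => // y /NUV[].
  by apply: subclosed_compact (@closed_closure _ N) cV _ => y /NUV[].
have [|s sZ sP] := @compact_finite_cover _ _ (fun x => (N x)°) cZ.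
  by move=> x /(NP x).2[Nx _]; exact: nbhs_interior.
pose B := \bigcup_(z in [set` s]) closure (N z).
have cB : compact B.
  by rewrite /B bigcup_seq; apply: bigsetU_compact => z _; have [] := NP z.
have QB : closure (\bigcup_(z in [set` s]) (N z)°) `<=` B.
  have /closure_id -> : closed B by exact: compact_closed.
  apply: closureS => x [z zs /interior_subset Nx].
  by exists z => //; exact: subset_closure.
exists (\bigcup_(z in [set` s]) (N z)°); split.
- by apply: bigcup_open => z _; exact: open_interior.
- exact: subclosed_compact (@closed_closure _ _) cB QB.
- move=> x Zx; have [z zs Nzx] := sP x Zx; by exists z.
- move=> x /QB[z zs]; have [_ /(_ (sZ z zs))[_]] := NP z; exact.
Qed.

(** * Perturbing sets against their translates *)

Section Action.
Variables (R : realType) (G : groupType) (X : topologicalType).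
Variables (alpha : G -> X -> X) (d : nat).
Hypothesis hX : hausdorff_space X.
Hypothesis lX : locally_compact [set: X].
Hypothesis alphaP : is_action alpha.
Hypothesis dimX : covering_dim_le (one_point_compactification X) d.

Lemma action1 x : alpha 1%g x = x. Proof. by have [_] := alphaP. Qed.

Lemma actionM g h x : alpha (g * h)%g x = alpha g (alpha h x).
Proof. by have [_ _] := alphaP. Qed.

Lemma actionK g : cancel (alpha g) (alpha g^-1%g).
Proof. by move=> x; rewrite -actionM mulVg action1. Qed.

Lemma actionVK g : cancel (alpha g^-1%g) (alpha g).
Proof. by move=> x; rewrite -actionM mulgV action1. Qed.

Lemma open_action g (A : set X) : open A -> open (alpha g @^-1` A).
Proof. by have [/(_ g)/continuousP + _ _] := alphaP; apply. Qed.

Lemma closed_action g (A : set X) : closed A -> closed (alpha g @^-1` A).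
Proof. by have [/(_ g)/continuous_closedP + _ _] := alphaP; apply. Qed.

Lemma compact_action g (A : set X) : compact A -> compact (alpha g @^-1` A).
Proof.
move=> cA; have -> : alpha g @^-1` A = alpha g^-1%g @` A.
  apply/seteqP; split=> [x Ax|_ [x Ax <-]]; last by rewrite /= actionVK.
  by exists (alpha g x) => //; rewrite actionK.
apply: continuous_compact => //; apply: continuous_subspaceT.
by have [] := alphaP.
Qed.

(** There are finitely many tuples of indices and elements of [N], and they are treated one after
    another: pull the sets back by the group elements, separate them, and translate the results
    back. What was achieved for earlier tuples survives, since the open sets only shrink and the
    compact sets only grow. *)
Lemma translate_partition (I : finType) (N : set G) (C U : I -> set X) :
  finite_set N -> (forall i, [/\ compact (C i), open (U i) & C i `<=` U i]) ->
  exists C' U' : I -> set X,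
    (forall i, [/\ compact (C' i), open (U' i), C i `<=` C' i,
                   C' i `<=` U' i & U' i `<=` U i]) /\
    forall (e : 'I_d.+1 -> I) (h : 'I_d.+1 -> G) x, injective e ->
      (forall a, N (h a)) ->
      ~ forall a, (U' (e a) `\` C' (e a)) (alpha (h a) x).
Proof.
move=> /finite_seqP[ns ->] CU.
pose S := {ffun 'I_d.+1 -> I * 'I_(size ns)}.
pose h (t : S) a := nth 1%g ns (t a).2.
suff step (ts : seq S) : exists C' U' : I -> set X,
    (forall i, [/\ compact (C' i), open (U' i), C i `<=` C' i,
                   C' i `<=` U' i & U' i `<=` U i]) /\
    forall t x, t \in ts -> injective (fun a => (t a).1) ->
      ~ forall a, (U' (t a).1 `\` C' (t a).1) (alpha (h t a) x).
  have [C' [U' [CU' CU'0]]] := step (enum S).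
  exists C', U'; split=> // e k x eI kN CUx.
  have idx a : (index (k a) ns < size ns)%N by rewrite index_mem; exact: (kN a).
  pose t : S := [ffun a => (e a, Ordinal (idx a))].
  apply: (CU'0 t x); first by rewrite mem_enum.
    by move=> a b; rewrite !ffunE => /eI.
  by move=> a; rewrite /h ffunE/= nth_index; [exact: CUx|exact: kN].
elim: ts => [|t ts [C' [U' [CU' CU'0]]]].
  by exists C, U; split=> // i; have [] := CU i; split.
have [tI|tNI] := pselect (injective (fun a => (t a).1)); last first.
  exists C', U'; split=> // t' x; rewrite inE => /orP[/eqP ->|]; first by [].
  exact: CU'0.
have [|D [V [DV DV0]]] := @locally_compact_partition R X d
    (fun a => alpha (h t a) @^-1` C' (t a).1)
    (fun a => alpha (h t a) @^-1` U' (t a).1) hX lX dimX.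
  move=> a; have [cC oU _ CU'a _] := CU' (t a).1; split.
  - exact: compact_action.
  - exact: open_action.
  - by move=> x; exact: CU'a.
(* Only the sets at indices occurring in [t] change. As these indices are distinct, each is assigned
   just one new set. *)
pose glue (B : I -> set X) (E : 'I_d.+1 -> set X) i :=
  if [pick a | (t a).1 == i] is Some a then alpha (h t a)^-1%g @^-1` E a
  else B i.
have glueE B E a : glue B E (t a).1 = alpha (h t a)^-1%g @^-1` E a.
  rewrite /glue; case: pickP => [b /eqP/tI ->//|/(_ a)].
  by rewrite eqxx.
have CU'' i : [/\ compact (glue C' D i), open (glue U' V i),
    C' i `<=` glue C' D i, glue C' D i `<=` glue U' V i
    & glue U' V i `<=` U' i].
  have [[a ia]|nia] := pselect (exists a, i = (t a).1).
    have [cD oV CD DVa VU] := DV a; rewrite ia !glueE; split.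
    - exact: compact_action.
    - exact: open_action.
    - by move=> x Cx; apply: CD; rewrite /= actionVK.
    - by move=> x; exact: DVa.
    - by move=> x /VU/=; rewrite actionVK.
  have [cC oU CC' CU'i U'U] := CU' i.
  rewrite /glue; case: pickP => [a /eqP ai|_]; last by split.
  by case: nia; exists a.
exists (glue C' D), (glue U' V); split=> [i|t' x].
  have [cC oU CC' CU'i U'U] := CU' i; have [cC2 oU2 CC2 CU2 UU2] := CU'' i.
  by split => //; [exact: subset_trans CC2|exact: subset_trans U'U].
rewrite inE => /orP[/eqP -> _ UCx|t'ts t'I UCx].
  by apply: (DV0 x) => a; have := UCx a; rewrite /setD/= !glueE /= actionK.
apply: (CU'0 t' x) => // a; have [_ _ CC2 _ UU2] := CU'' (t' a).1.
by have [/UU2 Ux nCx] := UCx a; split=> // /CC2.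
Qed.

(** * Greedy construction of the small open sets *)

Lemma separated_markers (I : finType) (N : set G) (C P : I -> set X) :
  finite_set N -> N 1%g ->
  (forall i, [/\ compact (C i), open (P i) & C i `<=` P i]) ->
  exists U : I -> set X, [/\ forall i, open (U i), forall i, U i `<=` P i,
    forall i x, C i x -> exists g j, N g /\ U j (alpha g x) &
    forall (e : 'I_d.+2 -> I) (g : 'I_d.+2 -> G) x, injective e ->
      (forall a b, N (g a * (g b)^-1)%g) ->
      ~ forall a, U (e a) (alpha (g a) x)].
Proof.
move=> fN N1 CP.
(* Covering is demanded of the compact cores [Z i], not just of the [U i], so that it survives when
   the [U i] are shrunk around their cores at later stages. *)
suff step (s : seq I) : exists Z U : I -> set X, [/\
    forall i, [/\ compact (Z i), open (U i), Z i `<=` U i & U i `<=` P i],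
    forall i, i \notin s -> U i = set0,
    forall i x, i \in s -> C i x -> exists g j, N g /\ Z j (alpha g x) &
    forall (e : 'I_d.+2 -> I) (g : 'I_d.+2 -> G) x, injective e ->
      (forall a b, N (g a * (g b)^-1)%g) ->
      ~ forall a, U (e a) (alpha (g a) x)].
  have [Z [U [ZU _ CZ U0]]] := step (enum I); exists U; split=> //.
  - by move=> i; have [] := ZU i.
  - by move=> i; have [] := ZU i.
  - move=> i x Cx; have [|g [j [Ng Zx]]] := CZ i x _ Cx.
      by rewrite mem_enum.
    by exists g, j; split=> //; have [_ _ ZUj _] := ZU j; exact: ZUj.
elim: s => [|j s [Z [U [ZU Us CZ U0]]]].
  exists (fun=> set0), (fun=> set0); split=> //.
    move=> i; split => //; [exact: compact0|exact: open0].
  by move=> e g x _ _ /(_ ord0).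
have [js|js] := boolP (j \in s).
  exists Z, U; split=> //.
    by move=> i; rewrite inE negb_or => /andP[_ /Us].
  by move=> i x; rewrite inE => /orP[/eqP ->|]; exact: CZ.
have [|Z' [U' [ZU' ZU'0]]] := translate_partition (C := Z) (U := U) fN.
  by move=> i; have [] := ZU i.
(* Two layers are put between [Z' i] and [U' i]: [W i] will be the new open set and [closure (Q i)]
   its new core. *)
have /choice[W WP] : forall i, exists W, [/\ open W, compact (closure W),
    Z' i `<=` W & closure W `<=` U' i].
  by move=> i; have [? ? _ ? _] := ZU' i; exact: compact_open_between.
have /choice[Q QP] : forall i, exists Q, [/\ open Q, compact (closure Q),
    Z' i `<=` Q & closure Q `<=` W i].
  move=> i; have [? _ _ _ _] := ZU' i; have [? _ ? _] := WP i.
  exact: compact_open_between.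
have WU i : W i `<=` U i.
  have [_ _ _ WU' ] := WP i; have [_ _ _ _ U'U] := ZU' i.
  by move=> x Wx; apply/U'U/WU'/subset_closure.
have W0 i : i \notin s -> W i = set0.
  by move=> /Us Ui; rewrite -subset0 -Ui; exact: WU.
have QW i : Q i `<=` W i.
  by have [_ _ _ QWi] := QP i; move=> x Qx; exact/QWi/subset_closure.
(* [NQ] consists of points already reached by the old markers, and [D] below of the points that the
   marker at [j] must avoid. Taking closures of the [W i] makes [D] closed. *)
pose NQ := \bigcup_(p in [set p : I * G | N p.2]) alpha p.2 @^-1` Q p.1.
have oNQ : open NQ.
  by apply: bigcup_open => p _; apply: open_action; have [] := QP p.1.
pose D := [set x | exists e h, [/\ injective e, forall a, N (h a) &
  forall a : 'I_d.+1, closure (W (e a)) (alpha (h a) x)]].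
have cD : closed D.
  have [ns nsE] := (@finite_seqP G N).1 fN.
  pose S := {ffun 'I_d.+1 -> I * 'I_(size ns)}.
  pose F (t : S) :=
    \bigcap_(a in [set: 'I_d.+1])
      alpha (nth 1%g ns (t a).2) @^-1` closure (W (t a).1).
  have -> : D = \bigcup_(t in [set t : S | injective (fun a => (t a).1)]) F t.
    apply/seteqP; split=> x.
      move=> [e [k [eI kN eW]]].
      have idx a : (index (k a) ns < size ns)%N.
        by rewrite index_mem; have := kN a; rewrite nsE.
      exists [ffun a => (e a, Ordinal (idx a))].
        by move=> a b; rewrite !ffunE; exact: eI.
      move=> a _; rewrite ffunE /= nth_index//.
      by rewrite -index_mem.
    move=> [t tI tW]; exists (fun a => (t a).1), (fun a => nth 1%g ns (t a).2).
    split=> // a; last exact: tW.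
    by rewrite nsE /= mem_nth.
  apply: closed_bigcup => [|t _]; first exact: finite_finset.
  apply: closed_bigI => a _; apply: closed_action; exact: closed_closure.
exists (fun i => if i == j then C j `\` NQ else closure (Q i)).
exists (fun i => if i == j then P j `\` D else W i).
split.
- move=> i; case: eqVneq => [->|ij].
    have [cC oP CPj] := CP j; split.
    + by rewrite setDE; apply: compact_closedI => //; exact: open_closedC.
    + by rewrite setDE; apply: openI => //; exact: closed_openC.
    (* A point of [D] outside [NQ] would have each [alpha (h a) x] in [U' (e a)] but not in
       [Q (e a)], hence not in [Z' (e a)], which the perturbation has excluded. *)
    + move=> x [Cx NQx]; split; first exact: CPj.
      move=> [e [h [eI hN hW]]]; apply: (ZU'0 e h x eI hN) => a.
      have [_ _ _ WU'] := WP (e a); split; first exact: WU'.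
      have [_ _ Z'Q _] := QP (e a).
      by move=> /Z'Q Qx; apply: NQx; exists (e a, h a) => //=.
    + by move=> x [].
  have [oW _ _ _] := WP i; have [_ cQ _ QWi] := QP i; split => //.
  by have [_ _ _ UP] := ZU i; exact: subset_trans UP.
- by move=> i; rewrite inE negb_or => /andP[/negPf -> /W0].
- move=> i x; rewrite inE => /orP[/eqP -> Cx|si Cx].
    have [[[k g] /= Ng Qx]|NQx] := pselect (NQ x).
      exists g, k; split => //; case: eqVneq => [kj|_].
        by move: Qx => /QW; rewrite kj W0.
      exact: subset_closure.
    by exists 1%g, j; rewrite eqxx action1; split.
  have [g [k [Ng Zx]]] := CZ i x si Cx; exists g, k; split => //.
  case: eqVneq => [kj|_].
    by have [_ _ /(_ _ Zx) + _] := ZU k; rewrite kj Us.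
  have [_ _ /(_ _ Zx) Z'x _ _] := ZU' k.
  by have [_ _ Z'Q _] := QP k; exact/subset_closure/Z'Q.
move=> e g x eI gN gU.
(* Without the index [j] the old separation applies. Otherwise the point [alpha (g a0) x] lies in
   the marker at [j], while the other [d.+1] conditions, rewritten relative to it, put it in [D]. *)
have [[a0 ea0]|nj] := pselect (exists a, e a = j); last first.
  apply: (U0 e g x eI gN) => a; apply: WU; have := gU a.
  by case: eqVneq => // ej; case: nj; exists a.
have := gU a0; rewrite ea0 eqxx => -[_]; apply.
exists (fun a => e (lift a0 a)), (fun a => g (lift a0 a) * (g a0)^-1)%g; split.
- by move=> a b /eI/lift_inj.
- by move=> a; exact: gN.
- move=> a; rewrite actionM actionK; apply: subset_closure.
  have := gU (lift a0 a); case: eqVneq => // ej.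
  by have := neq_lift a0 a; rewrite -(inj_eq eI) ea0 ej eqxx.
Qed.

(** * The long thin cover *)

(** Each pair with [alpha a x] and [alpha b x] distinct is handled by disjoint neighbourhoods of
    these two points, and there are finitely many pairs. The third clause will make the locally
    constant maps well defined and equivariant, the fourth will make their fibres small. *)
Lemma equivariant_nbhs (S : set G) (V : X -> set X) (x : X) :
  finite_set S -> (forall y, open (V y) /\ V y y) ->
  exists P : set X, [/\ open P, P x,
    forall a b z w, S a -> S b -> P z -> P w ->
      alpha a z = alpha b w -> alpha a x = alpha b x &
    forall g z, S g -> P z -> V (alpha g x) (alpha g z)].
Proof.
move=> fS VP.
have /choice[W WP] : forall p : G * G, exists W : set X, [/\ open W, W x &
    forall z w, W z -> W w -> alpha p.1 z = alpha p.2 w ->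
      alpha p.1 x = alpha p.2 x].
  move=> [a b] /=; have [abx|abx] := eqVneq (alpha a x) (alpha b x).
    by exists setT; split=> //; exact: openT.
  have := hX; rewrite open_hausdorff => /(_ _ _ abx)[[A B] /=].
  move=> [/set_mem Aa /set_mem Bb] [oA oB /eqP AB0].
  exists (alpha a @^-1` A `&` alpha b @^-1` B); split.
  - by apply: openI; exact: open_action.
  - by split.
  - move=> z w [Az _] [_ Bw] zw; have : (A `&` B) (alpha a z).
      by split => //; rewrite zw.
    by rewrite AB0.
exists ((\bigcap_(p in S `*` S) W p) `&`
        \bigcap_(g in S) alpha g @^-1` V (alpha g x)); split.
- apply: openI.
    apply: open_bigcap_fin => [|p _]; first exact: finite_setX.
    by have [] := WP p.
  apply: open_bigcap_fin => // g _; apply: open_action.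
  by have [] := VP (alpha g x).
- split=> [p _|g _]; first by have [] := WP p.
  by have [] := VP (alpha g x).
- move=> a b z w Sa Sb [zP _] [wP _].
  have [_ _] := WP (a, b); apply; [exact: zP|exact: wP].
- by move=> g z Sg [_ /(_ g Sg)].
Qed.

Lemma packing_long_thin_cover (N L : set G) (K : set X) (m n : nat) :
  finite_set N -> N 1%g -> [set a^-1%g | a in N] = N ->
  (forall k, (m < k)%N -> forall g : 'I_k -> G,
    (forall i, [set (a * b)%g | a in N & b in [set l^-1%g | l in L]] (g i)) ->
    exists F : {set 'I_k}, (d.+1 < #|F|)%N /\
      forall i j, i \in F -> j \in F -> N (g i * (g j)^-1)%g) ->
  finite_set L -> compact K ->
  [set (a * b)%g | a in L & b in N] #<= `I_n ->
  forall Vs : set (set X), open_cover Vs ->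
  exists (Us : set (set X)) (Lam : set X -> X -> X),
    (forall U, Us U -> open U /\ locally_constant_on U (Lam U)) /\
    [/\ forall x, K x ->
          exists2 U, Us U & [set alpha g x | g in L] `<=` U,
        (mult R Us <= m%:R%:E)%E,
        forall U x g, Us U -> U x -> L g -> U (alpha g x) ->
          Lam U (alpha g x) = alpha g (Lam U x),
        forall U y, Us U -> (Lam U @` U) y ->
          exists2 V, Vs V & (U `&` Lam U @^-1` [set y]) `|` [set y] `<=` V &
        forall U, Us U -> Lam U @` U #<= `I_n].
Proof.
move=> fN N1 Nsym pack fL cK; set S := (X in X #<= _) => Sn Vs [oV cV].
have NV g : N g -> N g^-1%g by rewrite -{2}Nsym => Ng; exists g.
have fS : finite_set S by apply/finite_set_leP; exists n.
(* Equivariance compares elements of [S] with products of an element of [L] and one of [S]. *)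
pose S' := S `|` [set (a * b)%g | a in L & b in S].
have SS' g : S g -> S' g by left.
have fS' : finite_set S'.
  by rewrite finite_setU; split => //; exact: finite_image2.
have /choice[Vf VfP] : forall y, exists V : set X, Vs V /\ V y.
  move=> y; have [V VsV Vy] : (\bigcup_(V in Vs) V) y by rewrite cV.
  by exists V.
have /choice[P PP] := fun x =>
  equivariant_nbhs x fS' (fun y => conj (oV _ (VfP y).1) (VfP y).2).
have /choice[Q QP] : forall x, exists Q : set X,
    [/\ open Q, compact (closure Q), Q x & closure Q `<=` P x].
  move=> x; have [oP Px _ _] := PP x.
  have [|Q [oQ cQ xQ QP]] := compact_open_between hX lX (@compact_set1 _ x) oP.
    by move=> _ ->.
  by exists Q; split => //; exact: xQ.
have [|xs _ xsP] := @compact_finite_cover _ _ Q cK.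
  by move=> x _; have [oQ _ Qx _] := QP x; exact: open_nbhs_nbhs.
pose I := 'I_(size xs); pose pt (i : I) := tnth (in_tuple xs) i.
have [|U [oU UP KU U0]] := @separated_markers I N
    (fun i => closure (Q (pt i))) (fun i => P (pt i)) fN N1.
  by move=> i; have [] := QP (pt i); have [] := PP (pt i).
pose B i := \bigcup_(g in S) alpha g^-1%g @^-1` U i.
have /choice[lam lamP] : forall p : I * X, exists z, B p.1 p.2 ->
    exists g, [/\ S g, U p.1 (alpha g^-1%g p.2) & z = alpha g (pt p.1)].
  move=> [i y] /=; have [[g Sg Uy]|nB] := pselect (B i y); last by exists y.
  by exists (alpha g (pt i)) => _; exists g.
have lamE i y g : S' g -> B i y -> U i (alpha g^-1%g y) ->
    lam (i, y) = alpha g (pt i).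
  move=> Sg By Uy; have [h [Sh Uhy ->]] := lamP (i, y) By.
  have [_ _ PI _] := PP (pt i).
  apply: (PI h g (alpha h^-1%g y) (alpha g^-1%g y)) => //=; rewrite ?actionVK//.
  - exact: SS'.
  - exact: UP.
  - exact: UP.
(* The cover is a set of sets, so indices with equal [B i] are merged; any one of them defines the
   map. *)
pose Lam (A : set X) y := if [pick i | `[< B i = A >]] is Some i then lam (i, y)
  else y.
have LamE A : range B A -> exists2 i, A = B i & Lam A = fun y => lam (i, y).
  move=> [i _ <-]; rewrite /Lam; case: pickP => [j /asboolP <-|/(_ i)].
    by exists j.
  by rewrite asboolT.
exists (range B), Lam; split=> [A /LamE[i -> ->]|].
  split; first by apply: bigcup_open => g _; exact: open_action.
  move=> x Bx; have [g [Sg Ux _]] := lamP (i, x) Bx.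
  rewrite /within/= (lamE _ _ _ (SS' _ Sg) Bx Ux).
  have : nbhs x (alpha g^-1%g @^-1` U i).
    by apply: open_nbhs_nbhs; split => //; exact: open_action.
  by apply: filterS => y Uy By; apply: lamE => //; exact: SS'.
split.
(* If [alpha g x] is in [U j] with [g] in [N], then [alpha l x] is its translate by [l * g^-1], an
   element of [S] by the symmetry of [N]. *)
- move=> x Kx; have [z zs Qx] := xsP x Kx.
  have zi : (index z xs < size xs)%N by rewrite index_mem.
  have [|g [j [Ng Ux]]] := KU (Ordinal zi) x.
    rewrite /pt (tnth_nth z)/= nth_index//; exact: subset_closure.
  exists (B j); first by exists j.
  move=> _ [l Ll <-]; exists (l * g^-1)%g.
    by exists l => //; exists g^-1%g => //; exact: NV.
  by rewrite /= -actionM invgM invgK -mulgA mulVg mulg1.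
- apply: ge_ereal_sup => _ [x _ <-].
  pose s : {set I} := [set i | `[< B i x >]]%SET.
  suff sm : (#|s| <= m)%N.
    apply: (@le_trans _ _ (size (enum s))%:R%:E).
      apply: (@le_counting_image R _ (enum s) _ B) => _ [[i _ <-] Bx].
      by exists i => //=; rewrite mem_enum inE; apply/asboolP.
    by rewrite lee_fin ler_nat -cardE.
  (* If more than [m] of the [B i] contain [x], inverting the elements of [S] that witness this
     gives elements of [N] times the inverse of [L]. Packing then selects [d.+2] indices forbidden
     by the separation of the [U i]. *)
  rewrite leqNgt; apply/negP => ms.
  have /choice[g gP] : forall a : 'I_#|s|, exists g, S g /\
      U (enum_val a) (alpha g^-1%g x).
    move=> a; have := enum_valP a; rewrite inE => /asboolP[g Sg Ux].
    by exists g.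
  have [|F [dF FN]] := pack _ ms (fun a => (g a)^-1%g).
    move=> a; have [[l Ll [k Nk <-]] _] := gP a; rewrite invgM.
    by exists k^-1%g; [exact: NV|exists l^-1%g => //; exists l].
  pose f (k : 'I_d.+2) : 'I_#|s| := enum_val (widen_ord dF k).
  apply: (U0 (fun k => enum_val (f k)) (fun k => (g (f k))^-1%g) x).
  + move=> k k' /enum_val_inj/enum_val_inj/(congr1 val)/= kk'.
    exact: val_inj.
  + by move=> k k'; apply: FN; exact: enum_valP.
  + by move=> k; have [] := gP (f k).
- move=> A x g /LamE[i -> ->] Bx Lg Bgx.
  have [h [Sh Ux ->]] := lamP (i, x) Bx; rewrite -actionM; apply: lamE => //.
    by right; exists g => //; exists h.
  by rewrite invgM actionM actionK.
- move=> A y /LamE[i -> ->] [x Bx xy]; exists (Vf y); first exact: (VfP y).1.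
  move=> w [[Bw /= wy]|->]; last exact: (VfP y).2.
  have [h [Sh Uw hE]] := lamP (i, w) Bw; rewrite -wy hE /=.
  have [_ _ _ /(_ h _ (SS' _ Sh) (UP _ _ Uw))] := PP (pt i).
  by rewrite /= actionVK.
(* All values lie in the image of [S] acting on the single point [pt i], so the bound does not
   depend on [Vs]. *)
- move=> A /LamE[i -> ->]; apply: card_le_trans Sn.
  apply: card_le_trans (card_image_le (fun g => alpha g (pt i)) S).
  apply: subset_card_le => _ [x Bx <-].
  by have [h [Sh _ ->]] := lamP (i, x) Bx; exists h.
Qed.

End Action.

Theorem theorem8p1 (R : realType) (G : groupType) (X : topologicalType)
    (alpha : G -> X -> X) (d : nat) :
  hausdorff_space X ->
  locally_compact [set: X] ->
  is_action alpha ->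
  (covering_dim R (one_point_compactification X) <= d%:R%:E)%E ->
  (dimLTC R alpha <= LSP R G d - 1)%E.
Proof.
move=> hX lX alphaP /covering_dimW dimX.
rewrite leeBrDr//; apply: le_ereal_inf_tmp => _ [m packing <-].
(* For [m = 0], a family of length 1 would have to contain more than [d.+1] indices. Positivity
   makes [m.-1] the right dimension, with multiplicity bound [m]. *)
have m_gt0 : (0 < m)%N.
  rewrite lt0n; apply/eqP => m0.
  have [N [fN N1 _ /(_ 1%N)]] := packing [set 1%g] (finite_set1 _).
  rewrite m0 => /(_ isT (fun=> 1%g))[].
    by move=> _; exists 1%g => //; exists 1%g => //; rewrite mulg1.
  by move=> F [/leq_trans/(_ (max_card _))]; rewrite card_ord.
rewrite -(prednK m_gt0) -natr1 EFinD leeD2r// ereal_inf_lbound//.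
exists m.-1 => // L K fL cK; rewrite prednK//.
have [N [fN N1 Nsym Npack]] := packing _ (finite_image (fun l => l^-1%g) fL).
have /finite_set_leP[n Sn] : finite_set [set (a * b)%g | a in L & b in N].
  exact: finite_image2.
exists n => Vs _ oVs.
by apply: packing_long_thin_cover alphaP dimX _ _ _ _ _ fN N1 Nsym Npack
  fL cK Sn Vs oVs.
Qed.
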